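(* Let $(\mathbf{C},I)$ be a $\sigma$-effectus. The following are equivalent. (i) $\mathbf{C}$ admits normalization. (ii) The effect monoid $\mathbf{C}(I,I)$ admits division: for any $s,t\in\mathbf{C}(I,I)$ with $s\le t$ and $t\neq0$, there is a unique $s/t\in\mathbf{C}(I,I)$ satisfying $(s/t)\cdot t=s$. (iii) The effect monoid $\mathbf{C}(I,I)$ has no nontrivial zero divisors, i.e. $s\cdot t=0$ implies $s=0$ or $t=0$. (iv) Every nonzero scalar $s\colon I\to I$ in $\mathbf{C}$ is an epimorphism.
   Context: Countable means finite (possibly empty) or countably infinite. A partial commutative monoid (PCM) is a set $X$ with $0\in X$ and a partial binary operation $\oplus$ with $(x\oplus y)\oplus z=x\oplus(y\oplus z)$, $x\oplus y=y\oplus x$, $0\oplus x=x$, where ''$=$'' is Kleene equality (if either side is defined, so is the other, and they are equal); $x\perp y$ means $x\oplus y$ is defined. An effect algebra is a PCM $E$ with an element $1\in E$ such that for each $a\in E$ there is a unique $a^{\perp}\in E$ with $a\oplus a^{\perp}=1$, and $a\perp 1$ implies $a=0$; it is partially ordered by $a\le b$ iff $a\oplus c=b$ for some $c$. A $\sigma$-PAM is a nonempty set $M$ with a partial operation $\bigoplus$ sending countable families $(x_j)_{j\in J}$ in $M$ to elements of $M$ (a family is summable if its sum is defined), such that: (partition-associativity) for each countable family $(x_j)_{j\in J}$ and countable partition $J=\biguplus_{k\in K}J_k$, the family is summable iff each $(x_j)_{j\in J_k}$ is summable and $(\bigoplus_{j\in J_k}x_j)_{k\in K}$ is summable, and then $\bigoplus_{j\in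 J}x_j=\bigoplus_{k\in K}\bigoplus_{j\in J_k}x_j$; (unary sum) one-element families are summable with sum their element; (limit) a countable family is summable whenever all its finite subfamilies are. A $\sigma$-PAM is a PCM with $x_1\oplus x_2=\bigoplus_{i\in\{1,2\}}x_i$ and $0=\bigoplus\emptyset$. A map between $\sigma$-PAMs is $\sigma$-additive if it sends summable families to summable families and preserves their sums; $\sigma$-biadditive means $\sigma$-additive in each argument. A $\sigma$-PAC is a category $\mathbf{C}$ with countable coproducts (coprojections $\kappa_i$), all of whose homsets are $\sigma$-PAMs with $\sigma$-biadditive composition (so there are zero morphisms $0_{AB}$), such that: (compatible sum) every compatible countable family $(f_j\colon A\to B)_{j\in J}$ is summable in $\mathbf{C}(A,B)$; (untying) if $f,g\colon A\to B$ are summable then so are $\kappa_1\circ f,\kappa_2\circ g\colon A\to B+B$. Here $(f_j\colon A\to B_j)_{j\in J}$ is compatible if there is $f\colon A\to\coprod_{j}B_j$ with $\triangleright_j\circ f=f_j$ for all $j$, where the partial projection $\triangleright_i\colon\coprod_jB_j\to B_i$ is determined by $\triangleright_i\circ\kappa_i=\mathrm{id}$ and $\triangleright_i\circ\kappa_k=0$ for $k\ne i$. A $\sigma$-effectus is a $\sigma$-PAC $\mathbf{C}$ with a distinguished object $I$ such that: (i) for each $A$, the PCM $\mathbf{C}(A,I)$ is an effect algebra, with top written $\mathbf{1}_A$; (ii) $\mathbf{1}_B\circ f=0_{AI}$ implies $f=0_{AB}$ for all $f\colon A\to B$; (iii) $\mathbf{1}_B\circ f\perp\mathbf{1}_B\circ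 g$ implies $f\perp g$ for all $f,g\colon A\to B$. A substate on $A$ is a morphism $\omega\colon I\to A$; it is a state if $\mathbf{1}_A\circ\omega=\mathbf{1}_I$. A scalar is a morphism $I\to I$. An effect monoid is an effect algebra with an associative total binary operation $\cdot$ that is biadditive (in each argument it preserves $0$ and all defined sums $\oplus$) and satisfies $a\cdot1=a=1\cdot a$. The scalars $\mathbf{C}(I,I)$ form an effect monoid with $\cdot$ given by composition, $s\cdot t=s\circ t$. The $\sigma$-effectus admits normalization if for each nonzero substate $\omega\colon I\to A$ there exists a unique state $\bar\omega\colon I\to A$ with $\omega=\bar\omega\circ(\mathbf{1}_A\circ\omega)$. *)

(* Defs.v *)
From mathcomp Require Import all_boot.

Set Implicit Arguments.
Unset Strict Implicit.
Unset Printing Implicit Defensive.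

(* Partial operations are valued in [option]: [None] means "undefined", so that
   Kleene equality is equality in [option]. *)

Record pcm := Pcm {
  pcm_car :> Type;
  pzero : pcm_car;
  padd : pcm_car -> pcm_car -> option pcm_car;
  paddA : forall x y z,
    obind (fun u => padd u z) (padd x y) = obind (fun v => padd x v) (padd y z);
  paddC : forall x y, padd x y = padd y x;
  padd0 : forall x, padd pzero x = Some x
}.
Arguments pzero {p}.
Arguments padd {p} x y.

Definition perp (X : pcm) (x y : X) : Prop := isSome (padd x y).

Definition is_effect_algebra (E : pcm) (one : E) : Prop :=
  (forall a : E, exists! b : E, padd a b = Some one) /\
  (forall a : E, perp a one -> a = pzero).

Record effectAlgebra := EffectAlgebra {
  ea_pcm :> pcm;
  ea_one : ea_pcm;
  ea_axiom : is_effect_algebra ea_one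
}.
Arguments ea_one {e}.

Definition ea_le (E : effectAlgebra) (a b : E) : Prop :=
  exists c : E, padd a c = Some b.

Definition pcm_additive (X Y : pcm) (f : X -> Y) : Prop :=
  f pzero = pzero /\
  forall x y z : X, padd x y = Some z -> padd (f x) (f y) = Some (f z).

Record effectMonoid := EffectMonoid {
  em_ea :> effectAlgebra;
  em_mul : em_ea -> em_ea -> em_ea;
  em_mulA : forall a b c, em_mul a (em_mul b c) = em_mul (em_mul a b) c;
  em_mul_additivel : forall b, pcm_additive (fun a => em_mul a b);
  em_mul_additiver : forall a, pcm_additive (fun b => em_mul a b);
  em_mulr1 : forall a, em_mul a ea_one = a;
  em_mul1r : forall a, em_mul ea_one a = a
}.

Definition admits_division (M : effectMonoid) : Prop :=
  forall s t : M, ea_le s t -> t <> pzero -> exists! q : M, em_mul q t = s.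

Definition no_zero_divisors (M : effectMonoid) : Prop :=
  forall s t : M, em_mul s t = pzero -> s = pzero \/ t = pzero.

(* Countable families are indexed by a [countType].  A countable partition of J
   into blocks indexed by K is a map [p : J -> K], the k-th block being the
   fibre of p over k; blocks may be empty. *)

Definition block (J K : countType) (p : J -> K) (k : K) : countType :=
  {j : J | p j == k}.

Definition restr (J : countType) (P : pred J) (M : Type) (x : J -> M) :
  {j : J | P j} -> M := fun j => x (val j).

(* [psum_partition] packs both directions of partition-associativity and the
   equality of the two sums: [y k] is the sum of the k-th block. *)
Record sigmaPAM := SigmaPAM {
  spam_car :> Type;
  psum : forall J : countType, (J -> spam_car) -> option spam_car;
  spam_inhabited : inhabited spam_car;
  psum_partition : forall (J K : countType) (p : J -> K) (x : J -> spam_car)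
      (m : spam_car),
    psum x = Some m <->
    exists y : K -> spam_car,
      (forall k, @psum (block p k) (restr x) = Some (y k)) /\
      psum y = Some m;
  psum_unary : forall (J : countType) (j0 : J) (x : J -> spam_car),
    (forall j, j = j0) -> psum x = Some (x j0);
  psum_limit : forall (J : countType) (x : J -> spam_car),
    (forall s : seq J, isSome (@psum {j : J | j \in s} (restr x))) ->
    isSome (psum x)
}.
Arguments psum {s J} x.

Definition summable (M : sigmaPAM) (J : countType) (x : J -> M) : Prop :=
  isSome (psum x).

Definition sigma_additive (M N : sigmaPAM) (f : M -> N) : Prop :=
  forall (J : countType) (x : J -> M) (m : M),
    psum x = Some m -> psum (fun j => f (x j)) = Some (f m).

Section SigmaPAMTheory.
Variable M : sigmaPAM.
Implicit Types (J K : countType).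

Lemma eq_psum J (x y : J -> M) : x =1 y -> psum x = psum y.
Proof.
have sub (u v : J -> M) m : u =1 v -> psum u = Some m -> psum v = Some m.
  move=> uv um; apply/(psum_partition id); exists u; split=> // k.
  pose k0 : block id k := exist _ k (eqxx k).
  rewrite (@psum_unary M _ k0) ?/restr /= ?uv // => -[j jk].
  by apply: val_inj => /=; apply/eqP.
move=> xy; case Ex: (psum x) => [m|].
  by rewrite (sub x y m).
by case Ey: (psum y) => [m|] //; rewrite (sub y x m) in Ex.
Qed.

Lemma psum_reindex J K (p : J -> K) (q : K -> J) (y : K -> M) :
  cancel p q -> cancel q p -> psum (fun j => y (p j)) = psum y.
Proof.
move=> pK qK.
have blk k : @psum M (block p k) (restr (fun j => y (p j))) = Some (y k).
  have qk : p (q k) == k by rewrite qK.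
  pose k0 : block p k := exist _ (q k) qk.
  rewrite (@psum_unary M _ k0) ?/restr /= ?qK // => -[j jk].
  by apply: val_inj => /=; rewrite -(eqP jk) pK.
have E m : psum (fun j => y (p j)) = Some m <-> psum y = Some m.
  split=> [/(psum_partition p)[z [zE]]|ym].
    by move=> <-; apply: eq_psum => k; apply: Some_inj; rewrite -zE blk.
  by apply/(psum_partition p); exists y.
case Ey: (psum y) => [m|]; first exact/E.
by case Ex: (psum _) => [m|] //; move/E: Ex; rewrite Ey.
Qed.

Lemma psum_block J J' K (p : J -> K) (x : J -> M) k (f : J' -> J) :
    injective f -> (forall j', p (f j') = k) ->
    (forall j, p j = k -> exists j', f j' = j) ->
  @psum M (block p k) (restr x) = psum (fun j' => x (f j')).
Proof.
move=> f_inj fk f_onto.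
have f_onto' (b : block p k) : exists j', f j' == val b.
  by have [j' <-] := f_onto (val b) (eqP (valP b)); exists j'.
pose g (j' : J') : block p k := exist _ (f j') (introT eqP (fk j')).
pose h b := xchoose (f_onto' b).
rewrite -(@psum_reindex _ _ g h) //.
  by move=> j'; apply: f_inj; apply/eqP; apply: (xchooseP (f_onto' (g j'))).
by move=> b; apply: val_inj => /=; apply/eqP; apply: (xchooseP (f_onto' b)).
Qed.

Lemma psum_void_summable : isSome (psum (of_void M)).
Proof.
have [a] := spam_inhabited M.
have /(psum_partition (fun _ => true))[y [yE _]] :
  psum (fun _ : unit => a) = Some a by rewrite (@psum_unary _ _ tt) // => -[].
have /psum_partition H := yE false.
have vP (b : block (fun _ : unit => true) false) : void by case: b.
have [z [_ zE]] := H _ vP.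
by rewrite (@eq_psum _ _ z) ?zE // => -[].
Qed.

Definition spam_zero : M :=
  match psum (of_void M) as o return isSome o -> M with
  | Some z => fun _ => z
  | None => fun no => False_rect M (notF no)
  end psum_void_summable.

Lemma psum_void : psum (of_void M) = Some spam_zero.
Proof.
by rewrite /spam_zero; move: psum_void_summable; case: (psum _).
Qed.

Definition spam_add (x y : M) : option M :=
  psum (fun b : bool => if b then x else y).

Lemma psum_split J (p : pred J) (x : J -> M) :
  psum x =
  obind (fun a => obind (spam_add a) (@psum M (block p false) (restr x)))
        (@psum M (block p true) (restr x)).
Proof.
have E m : psum x = Some m <->
  obind (fun a => obind (spam_add a) (@psum M (block p false) (restr x)))
        (@psum M (block p true) (restr x)) = Some m.
  split=> [/(psum_partition p)[y [yE ym]]|].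
    by rewrite !yE /= /spam_add -ym; apply: eq_psum => -[].
  case Ea: (@psum M (block p true) _) => [a|] //=.
  case Eb: (@psum M (block p false) _) => [b|] //= abm.
  apply/(psum_partition p).
  by exists (fun c : bool => if c then a else b); split=> // -[].
case Ex: (psum x) => [m|]; first by symmetry; apply/E.
by case Ey: (obind _ _) => [m|] //; move/E: Ey; rewrite Ex.
Qed.

Lemma psum_option J (x : option J -> M) :
  psum x = obind (fun a => spam_add a (x None)) (psum (fun j => x (Some j))).
Proof.
rewrite (psum_split isSome); congr obind.
  have E : @psum M (block isSome false) (restr x) = Some (x None).
    rewrite (@psum_block _ unit _ _ _ _ (fun _ => None)) //.
    - by rewrite (@psum_unary _ _ tt) // => -[].
    - by move=> [] [].
    - by case=> // _; exists tt.
  by rewrite E.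
all: rewrite (@psum_block _ J _ _ _ _ Some) //; first exact: Some_inj.
all: by case=> // j _; exists j.
Qed.

Lemma spam_addC x y : spam_add x y = spam_add y x.
Proof.
rewrite /spam_add -(@psum_reindex _ _ negb negb) //; try exact: negbK.
by apply: eq_psum => -[].
Qed.

Lemma spam_add0 x : spam_add spam_zero x = Some x.
Proof.
have <- : psum (fun _ : unit => x) = Some x.
  by rewrite (@psum_unary _ _ tt) // => -[].
rewrite (psum_split xpred0).
rewrite (@psum_block _ void _ _ _ true (@of_void _)) //.
rewrite (@eq_psum _ _ (of_void M)) ?psum_void /=; last by case.
rewrite (@psum_block _ unit _ _ _ false id) //; last by move=> j _; exists j.
by rewrite (@psum_unary _ _ tt) // => -[].
Qed.

Lemma spam_addA x y z :
  obind (fun u => spam_add u z) (spam_add x y) =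
  obind (fun v => spam_add x v) (spam_add y z).
Proof.
have E a b c : obind (fun u => spam_add u c) (spam_add a b) =
  psum (fun o : option bool => if o is Some d then if d then a else b else c).
  by rewrite psum_option.
rewrite E.
pose p (o : option bool) : option bool :=
  match o with Some true => None | Some false => Some true | None => Some false end.
pose q (o : option bool) : option bool :=
  match o with None => Some true | Some true => Some false | Some false => None end.
pose w (o : option bool) := if o is Some d then if d then y else z else x.
rewrite (@eq_psum _ _ (fun o => w (p o))); last by case=> [[]|].
rewrite (@psum_reindex _ _ p q w); try by case=> [[]|].
by rewrite -E; case: (spam_add y z) => //= v; rewrite spam_addC.
Qed.

Canonical spam_pcm : pcm := Pcm spam_addA spam_addC spam_add0.

End SigmaPAMTheory.
Coercion spam_pcm : sigmaPAM >-> pcm.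

Lemma sigma_additive_additive (M N : sigmaPAM) (f : M -> N) :
  sigma_additive f -> pcm_additive (X := M) (Y := N) f.
Proof.
move=> fS; split.
  have := fS _ _ _ (psum_void M).
  by rewrite (@eq_psum _ _ _ (of_void N)) ?psum_void => [[]|[]].
move=> x y z /fS <-; apply: eq_psum => -[] //.
Qed.

Declare Scope cat_scope.
Local Open Scope cat_scope.
Reserved Notation "g ∘ f" (at level 40, left associativity).

Record spamCategory := SpamCategory {
  ob :> Type;
  hom : ob -> ob -> sigmaPAM;
  idm : forall A, hom A A;
  mcomp : forall A B C, hom B C -> hom A B -> hom A C;
  comp_idl : forall A B (f : hom A B), mcomp (idm B) f = f;
  comp_idr : forall A B (f : hom A B), mcomp f (idm A) = f;
  compA : forall A B C D (h : hom C D) (g : hom B C) (f : hom A B),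
    mcomp h (mcomp g f) = mcomp (mcomp h g) f;
  comp_sigma_additivel : forall A B C (f : hom A B),
    sigma_additive (fun g : hom B C => mcomp g f);
  comp_sigma_additiver : forall A B C (g : hom B C),
    sigma_additive (fun f : hom A B => mcomp g f)
}.
Arguments hom {s} A B.
Arguments idm {s} A.
Arguments mcomp {s A B C} g f.
Notation "g ∘ f" := (mcomp g f) : cat_scope.

Definition is_epi (C : spamCategory) (A B : C) (f : hom A B) : Prop :=
  forall (D : C) (g h : hom B D), g ∘ f = h ∘ f -> g = h.

(* Coproducts are chosen; the notions below depend on the choice only up to
   isomorphism. *)
Record countableCoproducts (C : spamCategory) := CountableCoproducts {
  coprod : forall J : countType, (J -> C) -> C;
  kappa : forall (J : countType) (B : J -> C) (j : J), hom (B j) (coprod B);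
  cotuple : forall (J : countType) (B : J -> C) (D : C),
    (forall j, hom (B j) D) -> hom (coprod B) D;
  cotuple_kappa : forall (J : countType) (B : J -> C) (D : C)
      (f : forall j, hom (B j) D) (j : J),
    cotuple f ∘ kappa B j = f j;
  cotuple_uniq : forall (J : countType) (B : J -> C) (D : C)
      (f : forall j, hom (B j) D) (h : hom (coprod B) D),
    (forall j, h ∘ kappa B j = f j) -> h = cotuple f
}.
Arguments coprod {C} c {J} B.
Arguments kappa {C} c {J} B j.
Arguments cotuple {C} c {J B D} f.

Section PartialProjections.
Variables (C : spamCategory) (cp : countableCoproducts C).
Variables (J : countType) (B : J -> C).

(* The identity of [B i] if [k = i], and the zero morphism otherwise. *)
Definition kronecker (i k : J) : hom (B k) (B i) :=
  match k =P i with
  | ReflectT e => ecast i' (hom (B k) (B i')) e (idm (B k))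
  | ReflectF _ => pzero
  end.

Definition pproj (i : J) : hom (coprod cp B) (B i) := cotuple cp (kronecker i).

Lemma pproj_kappa_eq i : pproj i ∘ kappa cp B i = idm (B i).
Proof.
rewrite cotuple_kappa /kronecker; case: eqP => // e.
by rewrite eq_axiomK.
Qed.

Lemma pproj_kappa_neq i k : k <> i -> pproj i ∘ kappa cp B k = pzero.
Proof. by rewrite cotuple_kappa /kronecker; case: eqP. Qed.

Definition compatible (A : C) (f : forall j, hom A (B j)) : Prop :=
  exists g : hom A (coprod cp B), forall j, pproj j ∘ g = f j.

End PartialProjections.

(* B + B is the coproduct over [bool]; [true] is the first summand. *)
Record sigmaPAC := SigmaPAC {
  spac_cat :> spamCategory;
  spac_coprod : countableCoproducts spac_cat;
  compatible_sum : forall (J : countType) (A B : spac_cat) (f : J -> hom A B),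
    compatible spac_coprod (B := fun _ => B) f -> summable f;
  untying : forall (A B : spac_cat) (f g : hom A B),
    perp f g ->
    perp (kappa spac_coprod (fun _ : bool => B) true ∘ f)
         (kappa spac_coprod (fun _ : bool => B) false ∘ g)
}.

Record sigmaEffectus := SigmaEffectus {
  seff_pac :> sigmaPAC;
  unitob : seff_pac;
  truth : forall A : seff_pac, hom A unitob;
  truth_effect_algebra : forall A : seff_pac, is_effect_algebra (truth A);
  truth_comp0 : forall (A B : seff_pac) (f : hom A B),
    truth B ∘ f = pzero -> f = pzero;
  truth_comp_perp : forall (A B : seff_pac) (f g : hom A B),
    perp (truth B ∘ f) (truth B ∘ g) -> perp f g
}.
Arguments unitob {s}.
Arguments truth {s} A.

Section Scalars.
Variable C : sigmaEffectus.

Definition predicates (A : C) : effectAlgebra :=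
  EffectAlgebra (truth_effect_algebra A).

Lemma truth_unitob : truth unitob = idm unitob :> hom (unitob (s := C)) unitob.
Proof.
have [compl bot] := truth_effect_algebra (unitob (s := C)).
have [s [sE _]] := compl (idm unitob).
have [_ cadd] := sigma_additive_additive
  (comp_sigma_additiver (A := unitob) (truth (unitob (s := C)))).
have := cadd _ _ _ sE; rewrite comp_idr => tsE.
have /truth_comp0 s0 : truth unitob ∘ s = pzero.
  by apply: bot; rewrite /perp paddC tsE.
by move: sE; rewrite s0 paddC padd0 => -[].
Qed.

Lemma scalar_mulr1 (s : predicates unitob) : s ∘ truth unitob = s.
Proof. by rewrite truth_unitob comp_idr. Qed.

Lemma scalar_mul1r (s : predicates unitob) : truth unitob ∘ s = s.
Proof. by rewrite truth_unitob comp_idl. Qed.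

Definition scalars : effectMonoid :=
  @EffectMonoid (predicates unitob) (fun s t => s ∘ t)
    (@compA C unitob unitob unitob unitob)
    (fun t => sigma_additive_additive (comp_sigma_additivel t))
    (fun s => sigma_additive_additive (comp_sigma_additiver s))
    scalar_mulr1 scalar_mul1r.

Definition is_state (A : C) (w : hom unitob A) : Prop :=
  truth A ∘ w = truth unitob.

Definition admits_normalization : Prop :=
  forall (A : C) (w : hom unitob A), w <> pzero ->
    exists! v : hom unitob A, is_state v /\ w = v ∘ (truth A ∘ w).

End Scalars.

(* Main.v *)
Require Import Defs.
From mathcomp Require Import all_boot.
From Stdlib Require Import Classical_Prop.

(** Everything rests on the geometric series.  For a scalar [t] with
    orthosupplement [c], the partial sums of [t c^n] are the orthosupplements of
    the powers of [c], so [u] = sum of [t c^n] exists; comparing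
    [u = t + u c] with [1 = t + c] gives [u^⊥ t = 0].  Without zero divisors,
    [t <> 0] thus forces [u = 1].  Then [g t = h t] gives [g = g u = h u = h], so
    [t] is epi, and the substate [w] with [1 w = t] is normalized by the sum of
    [w c^n].  Conversely, normalizing the substate [κ1 s + κ2 s'] of [I + I],
    where [s + s' = t], yields the quotient [s / t] as its first component. *)

Set Implicit Arguments.
Unset Strict Implicit.
Unset Printing Implicit Defensive.

Local Open Scope cat_scope.

(** * Cancellation in effect algebras *)

Lemma padd_assocl (X : pcm) (a b c d m : X) :
  padd b c = Some d -> padd a d = Some m ->
  exists2 u, padd a b = Some u & padd u c = Some m.
Proof.
move=> bcE adE; have := paddA a b c; rewrite bcE /= adE.
by case: (padd a b) => //= u uE; exists u.
Qed.

(** With [m'] the orthosupplement of [m], both [b] and [d] are orthosupplements of [m' ⊕ a], and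
    these are unique. *)
Lemma padd_cancel (E : effectAlgebra) (a b d m : E) :
  padd a b = Some m -> padd a d = Some m -> b = d.
Proof.
have [compl _] := ea_axiom E => abE adE.
have [m' [m'E _]] := compl m.
rewrite paddC in m'E.
have [u uE ubE] := padd_assocl abE m'E.
have [v vE vdE] := padd_assocl adE m'E.
move: vE; rewrite uE => -[uv]; subst v.
by have [x [_ xU]] := compl u; rewrite -(xU b) // (xU d).
Qed.

(** * Subfamilies and series indexed by [nat] *)

Section SigmaPAMLemmas.
Variable M : sigmaPAM.

(** Deciding the image of [f] makes the subfamily one block of a two-block partition. *)
Lemma psum_subfamily (J : countType) (x : J -> M) (K : countType) (f : K -> J) :
  injective f -> isSome (psum x) ->
  (forall j, {k | f k = j} + {forall k, f k <> j}) ->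
  isSome (psum (fun k => x (f k))).
Proof.
move=> f_inj xS dec; pose p j : bool := dec j.
move: xS; rewrite (psum_split p) (@psum_block _ _ K _ _ _ true f) //.
- by case: (psum (fun k => x (f k))).
- by move=> k; rewrite /p; case: (dec (f k)) => [//|nf]; case: (nf k).
- by move=> j; rewrite /p; case: (dec j) => // -[k kE] _; exists k.
Qed.

Lemma psum_ord0 (x : 'I_0 -> M) : psum x = Some pzero.
Proof.
have no (i : 'I_0) : void by case: i.
rewrite -psum_void -(@psum_reindex _ _ _ (@of_void 'I_0) no) => [|[]|[] //].
by apply: eq_psum => -[].
Qed.

Lemma psum_ordS n (x : nat -> M) :
  psum (fun i : 'I_n.+1 => x i) =
  obind (fun a => padd a (x n)) (psum (fun i : 'I_n => x i)).
Proof.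
pose p := unlift (@ord_max n).
pose q (o : option 'I_n) := if o is Some i then lift ord_max i else ord_max.
have qK : cancel q p by case=> [i|]; rewrite /p /= ?liftK ?unlift_none.
have pK : cancel p q by move=> i; rewrite /p; case: unliftP => [j|] ->.
rewrite -(psum_reindex _ qK pK) psum_option /=.
by congr obind; apply: eq_psum => i; congr x; apply: lift_max.
Qed.

Lemma psum_natS (x : nat -> M) :
  psum x = obind (fun a => padd a (x 0)) (psum (fun n => x n.+1)).
Proof.
pose p n := if n is m.+1 then Some m else None.
pose q (o : option nat) := if o is Some m then m.+1 else 0.
rewrite -(@psum_reindex _ _ _ q p) ?psum_option //; first by case.
by case.
Qed.

(** The limit axiom asks for all finite subfamilies, and each of them sits inside an initial
    segment. *)
Lemma summable_nat (x : nat -> M) :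
  (forall n, isSome (psum (fun i : 'I_n => x i))) -> summable x.
Proof.
move=> xS; apply: psum_limit => s.
pose n := (\max_(i <- s) i).+1.
have lt_n (j : {j | j \in s}) : val j < n.
  exact: (leq_bigmax_seq (F := id)) (valP j) isT.
pose f j := Ordinal (lt_n j).
have f_inj : injective f by move=> j k [jk]; apply: val_inj.
apply: (psum_subfamily f_inj (xS n)) => i.
have [is_|nis] := boolP (val i \in s).
  by left; exists (exist _ (val i) is_); apply: val_inj.
by right=> k kE; case/negP: nis; rewrite -kE (valP k).
Qed.

End SigmaPAMLemmas.

(** * Sums, zeros and powers under composition *)

Section Composition.
Variable C : spamCategory.
Implicit Types A B D : C.

Lemma comp_addl A B D (f : hom A B) (g h k : hom B D) :
  padd g h = Some k -> padd (g ∘ f) (h ∘ f) = Some (k ∘ f).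
Proof.
by case: (sigma_additive_additive (comp_sigma_additivel (C := D) f)) => _; apply.
Qed.

Lemma comp_addr A B D (f : hom B D) (g h k : hom A B) :
  padd g h = Some k -> padd (f ∘ g) (f ∘ h) = Some (f ∘ k).
Proof.
by case: (sigma_additive_additive (comp_sigma_additiver (A := A) f)) => _; apply.
Qed.

Lemma comp0l A B D (f : hom A B) : (pzero : hom B D) ∘ f = pzero.
Proof.
by case: (sigma_additive_additive (comp_sigma_additivel (C := D) f)).
Qed.

Lemma comp0r A B D (f : hom B D) : f ∘ (pzero : hom A B) = pzero.
Proof.
by case: (sigma_additive_additive (comp_sigma_additiver (A := A) f)).
Qed.

Fixpoint cpow A (c : hom A A) n : hom A A :=
  if n is m.+1 then c ∘ cpow c m else idm A.

Lemma cpow_comm A (c t : hom A A) n : c ∘ t = t ∘ c -> cpow c n ∘ t = t ∘ cpow c n.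
Proof.
move=> ct; elim: n => [|n IH] /=; first by rewrite comp_idl comp_idr.
by rewrite -Defs.compA IH !Defs.compA ct.
Qed.

End Composition.

(** * Truth, substates of [I + I] and division *)

Section Effectus.
Variable C : sigmaEffectus.
Notation I := (unitob (s := C)).
Notation cp := (spac_coprod C).

Lemma hom_unit_cancel (A : C) (a b d m : hom A I) :
  padd a b = Some m -> padd a d = Some m -> b = d.
Proof. exact: (@padd_cancel (predicates A)). Qed.

Lemma complP (A : C) (a : hom A I) : exists b, padd a b = Some (truth A).
Proof. by have [/(_ a)[b [bE _]] _] := truth_effect_algebra A; exists b. Qed.

(** The cotuple of the truths lies below the truth of the coproduct; their difference [x], composed
    with the coprojection, is orthogonal to the top and hence zero. *)
Lemma truth_kappa (J : countType) (B : J -> C) j :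
  truth (coprod cp B) ∘ kappa cp B j = truth (B j).
Proof.
have [x xE] := complP (cotuple cp (fun j => truth (B j))).
have := comp_addl (kappa cp B j) xE; rewrite cotuple_kappa => jE.
have [_ bot] := truth_effect_algebra (B j).
have [b bE] := complP (truth (coprod cp B) ∘ kappa cp B j).
have x0 : x ∘ kappa cp B j = pzero.
  by apply: bot; rewrite /perp paddC jE.
by move: jE; rewrite x0 paddC padd0 => -[].
Qed.

(** Encodes a sum of scalars as a substate of [I + I], so that normalizing it divides both summands
    by [m] at once. *)
Lemma untying_sum (a b m : hom I I) : padd a b = Some m ->
  exists w : hom I (coprod cp (fun _ : bool => I)),
  [/\ padd (kappa cp _ true ∘ a) (kappa cp _ false ∘ b) = Some w,
      truth _ ∘ w = m & pproj cp _ true ∘ w = a].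
Proof.
move=> abE; have := @untying C _ _ a b; rewrite /perp abE => /(_ isT).
case wE: (padd _ _) => [w|] // _; exists w; split=> //.
  have := comp_addr (truth _) wE.
  by rewrite !Defs.compA !truth_kappa truth_unitob !comp_idl abE => -[].
have := comp_addr (pproj cp _ true) wE.
rewrite !Defs.compA pproj_kappa_eq pproj_kappa_neq // comp_idl comp0l.
by rewrite paddC padd0 => -[].
Qed.

Lemma normalization_division :
  admits_normalization C -> admits_division (scalars C).
Proof.
move=> norm s t [s' ss'E] t0.
have [w [wE wt ws]] := untying_sum ss'E.
have w0 : w <> pzero.
  by move=> w0; apply: t0; rewrite -wt w0; apply: comp0r.
have [v [[v1 vw] vU]] := norm _ _ w0.
rewrite wt in vw vU.
exists (pproj cp _ true ∘ v); split=> [|q qt].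
  by rewrite -ws vw Defs.compA.
(* Any quotient [q], completed by its orthosupplement [r], gives a state [y] with [y ∘ t = w];
   uniqueness of the normalization then determines [q]. *)
have [r qrE] := complP (q : hom I I).
have [y [yE yt yq]] := untying_sum qrE.
suff -> : v = y by [].
apply: vU; split=> //.
have := comp_addl (t : hom I I) qrE.
rewrite truth_unitob comp_idl => qtE.
have rt : r ∘ t = s' by apply: hom_unit_cancel qtE _; rewrite -[q ∘ t]/(em_mul q t) qt.
have := comp_addl (t : hom I I) yE.
by rewrite -!Defs.compA rt -[q ∘ t]/(em_mul q t) qt wE => -[].
Qed.

(** Both [s] and zero are quotients of zero by [t]. *)
Lemma division_no_zero_divisors :
  admits_division (scalars C) -> no_zero_divisors (scalars C).
Proof.
move=> div s t st0; have [->|t0] := classic (t = pzero); first by right.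
have zt : ea_le (pzero : scalars C) t by exists t; apply: padd0.
have [q [_ qU]] := div _ _ zt t0.
by left; rewrite -(qU s) // (qU pzero) //; apply: comp0l.
Qed.

(** * Geometric series *)

Lemma partial_sum_powers (A : C) (w : hom I A) (c : hom I I) :
  padd (truth A ∘ w) c = Some (truth I) ->
  forall n, exists2 v, psum (fun i : 'I_n => w ∘ cpow c i) = Some v &
    padd (truth A ∘ v) (cpow c n) = Some (truth I).
Proof.
move=> tcE; elim=> [|n [v vE vcE]].
  exists pzero; last by rewrite comp0r padd0 truth_unitob.
  exact: psum_ord0.
(* The remainder [c^n] splits into the truth value of the next term and the new remainder
   [c^(n+1)]. *)
have := comp_addl (cpow c n) tcE; rewrite truth_unitob comp_idl => cnE.
have [u uE ucE] := padd_assocl cnE vcE.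
have : perp v (w ∘ cpow c n) by apply: truth_comp_perp; rewrite /perp Defs.compA uE.
rewrite /perp; case v'E: (padd _ _) => [v'|] // _.
exists v'; first by rewrite (psum_ordS n (fun i => w ∘ cpow c i)) vE.
by have := comp_addr (truth A) v'E; rewrite Defs.compA uE -truth_unitob => -[<-].
Qed.

Lemma geometric_sum (A : C) (w : hom I A) (c : hom I I) :
  padd (truth A ∘ w) c = Some (truth I) ->
  exists v, psum (fun n => w ∘ cpow c n) = Some v.
Proof.
move=> tcE; have : summable (fun n => w ∘ cpow c n).
  by apply: summable_nat => n; have [v ->] := partial_sum_powers tcE n.
by rewrite /summable; case: psum => // v _; exists v.
Qed.

(** Both [c t] and [t c] complete [t t] to [t]. *)
Lemma compl_comm (t c : hom I I) : padd t c = Some (truth I) -> c ∘ t = t ∘ c.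
Proof.
move=> tcE; have := comp_addr t tcE; have := comp_addl t tcE.
by rewrite truth_unitob comp_idl comp_idr; apply: hom_unit_cancel.
Qed.

Lemma geometric_sum_unit (t c : hom I I) :
  no_zero_divisors (scalars C) -> t <> pzero -> padd t c = Some (truth I) ->
  psum (fun n => t ∘ cpow c n) = Some (truth I).
Proof.
move=> nzd t0 tcE.
have [|u uE] := @geometric_sum I t c; first by rewrite {1}truth_unitob comp_idl.
have ucE : padd (u ∘ c) t = Some u.
  rewrite -uE psum_natS /= comp_idr.
  suff -> : psum (fun n => t ∘ (c ∘ cpow c n)) = Some (u ∘ c) by [].
  rewrite -(comp_sigma_additivel c uE); apply: eq_psum => n.
  by rewrite -Defs.compA cpow_comm.
(* Inserting [c = u c + r c] into [t + c = 1] gives [u + r c = 1], so [r c = r]; then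
   [r t + r c = r] forces [r t = 0]. *)
have [r urE] := complP u.
have urcE := comp_addl c urE.
rewrite truth_unitob comp_idl in urcE.
rewrite paddC in ucE.
have [x xE xrE] := padd_assocl urcE tcE.
have rc : r ∘ c = r.
  by move: xE xrE; rewrite ucE => -[<-] /hom_unit_cancel; apply.
have := comp_addr r tcE; rewrite {1}truth_unitob comp_idr rc paddC => rtE.
have rt0 : r ∘ t = pzero.
  by apply: hom_unit_cancel rtE _; rewrite paddC padd0.
have [r0|/t0 []] := nzd r t rt0.
by move: urE; rewrite uE r0 paddC padd0.
Qed.

Lemma no_zero_divisors_epi : no_zero_divisors (scalars C) ->
  forall t : hom I I, t <> pzero -> is_epi t.
Proof.
move=> nzd t t0 D g h ght; have [c tcE] := complP t.
have uE := geometric_sum_unit nzd t0 tcE.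
have := comp_sigma_additiver g uE; have := comp_sigma_additiver h uE.
rewrite truth_unitob !comp_idr => hE gE.
apply: Some_inj; rewrite -gE -hE; apply: eq_psum => n.
by rewrite !Defs.compA ght.
Qed.

Lemma epi_no_zero_divisors : (forall t : hom I I, t <> pzero -> is_epi t) ->
  no_zero_divisors (scalars C).
Proof.
move=> epi s t st0; have [->|t0] := classic (t = pzero); first by right.
by left; apply: (epi t t0); rewrite comp0l.
Qed.

Lemma normalized_substate (A : C) (w : hom I A) :
  no_zero_divisors (scalars C) -> w <> pzero ->
  exists2 v, is_state v & w = v ∘ (truth A ∘ w).
Proof.
move=> nzd w0; set t := truth A ∘ w; have [c tcE] := complP t.
have t0 : t <> pzero by move=> /truth_comp0.
have uE := geometric_sum_unit nzd t0 tcE.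
have [v vE] := geometric_sum tcE.
exists v.
  apply: Some_inj; rewrite -uE -(comp_sigma_additiver (truth A) vE).
  by apply: eq_psum => n; rewrite Defs.compA.
(* Powers of [c] commute with [t], so [v t] is [w] composed with the series of the [t c^n], whose
   sum is 1. *)
apply: Some_inj; rewrite -(comp_sigma_additivel t vE).
have := comp_sigma_additiver w uE; rewrite truth_unitob comp_idr => <-.
apply: eq_psum => n.
by rewrite -Defs.compA cpow_comm //; apply: compl_comm.
Qed.

(** For uniqueness, two normalizations of [w] agree after precomposition with the nonzero scalar
    [truth A ∘ w], which is epi. *)
Lemma epi_normalization : (forall t : hom I I, t <> pzero -> is_epi t) ->
  admits_normalization C.
Proof.
move=> epi A w w0.
have [v v1 vw] := normalized_substate (epi_no_zero_divisors epi) w0.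
exists v; split=> // v' [_ vw']; apply: (epi (truth A ∘ w)); last by rewrite -vw.
by move=> /truth_comp0.
Qed.

End Effectus.

Theorem theorem40 (C : sigmaEffectus) :
  [<-> admits_normalization C;
       admits_division (scalars C);
       no_zero_divisors (scalars C);
       forall s : hom (unitob (s := C)) unitob, s <> pzero -> is_epi s].
Proof.
tfae.
- exact: normalization_division.
- exact: division_no_zero_divisors.
- exact: no_zero_divisors_epi.
- exact: epi_normalization.
Qed.
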